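(* Let $\mathcal H$ be a Hilbert space, $V\subseteq\mathcal H$ a closed subspace with orthogonal projector $P$, and $f\in\mathcal H$. Let $F_q$ be a finite-dimensional inner product space, $T_q:F_q\to\mathcal H$ a bounded linear operator, and $\tau\ge0$. Put $$R_q=(I-P)T_q,\qquad D_q=R_q^*R_q,\qquad b_q=R_q^*(f-Pf),$$ let $\Pi_{q,\tau}$, $D_{q,\tau}^{\dagger}$ be as in the context, and put $$\Gamma_q=\langle b_q,D_{q,\tau}^{\dagger}b_q\rangle,\qquad W_q=R_q\Pi_{q,\tau}(F_q).$$ Let $P_{V+W_q}$ be the orthogonal projector onto $V+W_q$. Then $$\|f-Pf\|^2-\|f-P_{V+W_q}f\|^2=\Gamma_q .$$ Moreover, every retained quotient direction has innovation energy at least $\tau$, i.e. $\langle D_qv,v\rangle\ge\tau\|v\|^2$ for every $v$ in the range of $\Pi_{q,\tau}$, and, if $\tau>0$, the minimum-norm update satisfies $$\|D_{q,\tau}^{\dagger}b_q\|\le\tau^{-1}\|\Pi_{q,\tau}b_q\| .$$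
   Context: $\Pi_{q,\tau}$ is the spectral projector of the positive semidefinite self-adjoint operator $D_q$ on $F_q$ for the spectral set $[\tau,\infty)$, with the zero eigenvalue omitted when $\tau=0$ (so for $\tau=0$ it is the projector onto the sum of eigenspaces with positive eigenvalue). $D_{q,\tau}^{\dagger}$ is the operator on $F_q$ that is the inverse of $D_q$ on the range of $\Pi_{q,\tau}$ and zero on its orthogonal complement. *)

(* Defs.v *)
From HB Require Import structures.
From mathcomp Require Import all_boot all_order all_algebra.
From mathcomp Require Import sesquilinear.
From mathcomp Require Import complex.
From mathcomp Require Import boolp classical_sets reals topology normedtype.

Set Implicit Arguments.
Unset Strict Implicit.
Unset Printing Implicit Defensive.

Import Order.TTheory GRing.Theory Num.Theory.
Import numFieldNormedType.Exports.

Local Open Scope classical_set_scope.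
Local Open Scope ring_scope.

(* A Hilbert space has real or complex scalars; both cases are covered by
   quantifying over [scalar_kind]. *)
Variant scalar_kind := RealScalars | ComplexScalars.

Definition scalar_field (R : realType) (k : scalar_kind) : numFieldType :=
  match k with
  | RealScalars => R
  | ComplexScalars => R[i]
  end.

Definition scalar_conj (R : realType) (k : scalar_kind) :
    {rmorphism scalar_field R k -> scalar_field R k} :=
  match k with
  | RealScalars => idfun
  | ComplexScalars => @Num.conj R[i]
  end.

(* [{dot V for theta}] is linear in its first argument and theta-semilinear in
   the second; the norm (hence the topology) is the one it induces. *)
HB.mixin Record isInnerProductSpace (K : numFieldType)
    (theta : {rmorphism K -> K}) V of NormedModule K V := {
  inner : {dot V for theta};
  inner_norm : forall x : V, inner x x = `|x| ^+ 2
}.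

#[short(type="innerProductType")]
HB.structure Definition InnerProductSpace (K : numFieldType)
    (theta : {rmorphism K -> K}) :=
  {V of NormedModule K V & isInnerProductSpace K theta V}.

#[short(type="hilbertType")]
HB.structure Definition Hilbert (K : numFieldType)
    (theta : {rmorphism K -> K}) :=
  {V of InnerProductSpace K theta V & Complete V}.

#[short(type="euclideanType")]
HB.structure Definition Euclidean (K : numFieldType)
    (theta : {rmorphism K -> K}) :=
  {V of InnerProductSpace K theta V & Vector K V}.

Section Operators.
Context {K : numFieldType} {theta : {rmorphism K -> K}}.

Definition subspace_add (V : lmodType K) (A B : set V) : set V :=
  [set x + y | x in A & y in B].

Definition bounded_operator (U V : normedModType K) (T : U -> V) : Prop :=
  exists M : K, forall x : U, `|T x| <= M * `|x|.

(* [orth_proj A x] is the point of [A] whose difference to [x] is orthogonal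
   to [A]; it is unique when it exists (e.g. for [A] a closed subspace of a
   Hilbert space). *)
Definition orth_proj (V : innerProductType theta) (A : set V) (x : V) : V :=
  xget 0 [set p | A p /\ forall a, A a -> inner (x - p) a = 0].

Definition adjoint (U V : innerProductType theta) (T : U -> V) (y : V) : U :=
  xget 0 [set u | forall x, inner (T x) y = inner x u].

End Operators.

Section Spectral.
Context {K : numFieldType} {theta : {rmorphism K -> K}}.
Variable F : euclideanType theta.

(* Membership in [tau, +oo), without 0 when tau = 0.  For complex scalars the
   order forces such a [lambda] to be real. *)
Definition retained (tau lambda : K) : Prop :=
  tau <= lambda /\ (tau = 0 -> lambda <> 0).

(* The sum of the eigenspaces of the retained eigenvalues, as the set of finite
   sums of their elements. *)
Definition spectral_subspace (D : 'End(F)) (tau : K) : set F :=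
  [set v | exists (n : nat) (w : 'I_n -> F), v = \sum_(i < n) w i /\
     forall i, exists2 lambda, retained tau lambda
                             & w i \in passmx.leigenspace D lambda].

Definition spectral_proj (D : 'End(F)) (tau : K) : F -> F :=
  orth_proj (spectral_subspace D tau).

Definition spectral_pinv (D : 'End(F)) (tau : K) : 'End(F) :=
  xget 0 [set G : 'End(F) |
    (forall v, range (spectral_proj D tau) v ->
       [/\ range (spectral_proj D tau) (G v), G (D v) = v & D (G v) = v]) /\
    (forall v, (forall u, range (spectral_proj D tau) u -> inner v u = 0) ->
       G v = 0)].

End Spectral.

(* Main.v *)
(**
  Since W is orthogonal to V, the projection of f onto V + W is P f + R u with
  u = D^+ b: the residual f - P f - R u is orthogonal to V, and against R v for v
  in the spectral subspace S it gives <b - D u, v> = <b - Pi b, v> = 0.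
  Pythagoras then yields an innovation |R u|^2 = <D u, u> = <b, u>.
  Lower bounds on S come from writing v as a sum of eigenvectors with distinct
  eigenvalues, which are pairwise orthogonal; no diagonalization of D is needed.
*)
Require Import Defs.
From HB Require Import structures.
From mathcomp Require Import all_boot all_order all_algebra.
From mathcomp Require Import sesquilinear complex ring.
From mathcomp Require Import boolp classical_sets reals topology normedtype.

Import Order.TTheory GRing.Theory Num.Theory.
Import numFieldNormedType.Exports.

Local Open Scope classical_set_scope.
Local Open Scope ring_scope.

Set Implicit Arguments.
Unset Strict Implicit.

(** * Inner product identities, linear subspaces as sets, and orthogonal projections *)

Section InnerProduct.
Context {K : numFieldType} {theta : {rmorphism K -> K}}.
Context {V : innerProductType theta}.
Implicit Types (x y z : V) (a : K) (A B : set V).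

Lemma innerC x y : inner x y = theta (inner y x).
Proof. by rewrite (hermC inner) /= expr0 mul1r. Qed.

Lemma innerZl a x y : inner (a *: x) y = a * inner x y.
Proof. exact: (linearZl_LR inner). Qed.

Lemma innerZr a x y : inner x (a *: y) = theta a * inner x y.
Proof. exact: (linearZr_LR inner). Qed.

Lemma innerDl x y z : inner (x + y) z = inner x z + inner y z.
Proof. exact: (linearDl inner). Qed.

Lemma innerDr x y z : inner x (y + z) = inner x y + inner x z.
Proof. exact: (linearDr inner). Qed.

Lemma innerBl x y z : inner (x - y) z = inner x z - inner y z.
Proof. exact: (linearBl inner). Qed.

Lemma innerBr x y z : inner x (y - z) = inner x y - inner x z.
Proof. exact: (linearBr inner). Qed.

Lemma inner0l x : inner 0 x = 0.
Proof. exact: (linear0l inner). Qed.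

Lemma inner0r x : inner x 0 = 0.
Proof. exact: (linear0r inner). Qed.

Lemma inner_eq0C x y : inner x y = 0 -> inner y x = 0.
Proof. by move=> xy; rewrite innerC xy rmorph0. Qed.

Lemma inner_ge0 x : 0 <= inner x x.
Proof. by rewrite inner_norm exprn_ge0. Qed.

Lemma inner_eq0 x : inner x x = 0 -> x = 0.
Proof. by rewrite inner_norm => /eqP; rewrite sqrf_eq0 normr_eq0 => /eqP. Qed.

Lemma inner_inj x y : (forall z, inner z x = inner z y) -> x = y.
Proof.
by move=> e; apply/subr0_eq/inner_eq0; rewrite innerBr e subrr.
Qed.

(** [theta] is given only as a ring morphism. Hermitian symmetry used twice on [inner (a *: x) x]
    yields the identity times [inner x x], which a nonzero [x] allows to cancel. *)
Lemma conj_involutive x a : x != 0 -> theta (theta a) = a.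
Proof.
move=> x0; apply: (@mulIf _ (inner x x)); first exact: lt0r_neq0 (neq0_dnorm_gt0 x x0).
by rewrite -[RHS]innerZl [RHS]innerC innerZr rmorphM -innerC.
Qed.

Lemma pythagoras x y : inner x y = 0 -> `|x + y| ^+ 2 = `|x| ^+ 2 + `|y| ^+ 2.
Proof. by rewrite -!inner_norm => /hnormDd. Qed.

(** Pythagoras for [x = (x - c *: y) + c *: y], with [c *: y] the component of [x] along [y], gives
    [|c *: y| <= |x|]; the claim is this bound times [|y|]. *)
Lemma cauchy_schwarz x y : `|inner x y| <= `|x| * `|y|.
Proof.
have [->|y0] := eqVneq y 0; first by rewrite inner0r !normr0 mulr0.
pose c := inner x y / inner y y.
have cy : inner x y = c * inner y y.
  by rewrite divfK // gt_eqF // neq0_dnorm_gt0.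
have o : inner (x - c *: y) (c *: y) = 0.
  by rewrite innerZr innerBl innerZl cy subrr mulr0.
rewrite cy inner_norm normrM normrX normr_id expr2 mulrA -normrZ ler_wpM2r //.
rewrite -(@ler_pXn2r _ 2) ?nnegrE // -[in leRHS](subrK (c *: y) x) pythagoras //.
by rewrite lerDr exprn_ge0.
Qed.

Lemma parallelogram x y :
  `|x + y| ^+ 2 + `|x - y| ^+ 2 = 2 * `|x| ^+ 2 + 2 * `|y| ^+ 2.
Proof.
rewrite -!inner_norm !(innerBl, innerBr, innerDl, innerDr).
by ring.
Qed.

Lemma submod0 A : GRing.submod_closed [in A] -> A 0.
Proof. by case=> /set_mem. Qed.

Lemma submodP A : GRing.submod_closed [in A] ->
  forall a x y, A x -> A y -> A (a *: x + y).
Proof. by case=> _ h a x y Ax Ay; apply/set_mem/h; exact/mem_set. Qed.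

Lemma submodD A : GRing.submod_closed [in A] ->
  forall x y, A x -> A y -> A (x + y).
Proof. by move=> h x y Ax Ay; rewrite -[x]scale1r; exact: submodP. Qed.

Lemma submodZ A : GRing.submod_closed [in A] -> forall a x, A x -> A (a *: x).
Proof.
by move=> h a x Ax; rewrite -[_ *: _]addr0; apply: submodP => //; exact: submod0.
Qed.

Lemma submodB A : GRing.submod_closed [in A] ->
  forall x y, A x -> A y -> A (x - y).
Proof.
by move=> h x y Ax Ay; rewrite addrC -scaleN1r; exact: submodP.
Qed.

Lemma submod_closedI A : A 0 -> (forall a x y, A x -> A y -> A (a *: x + y)) ->
  GRing.submod_closed [in A].
Proof.
by move=> A0 h; split=> [|a x y /set_mem Ax /set_mem Ay]; apply/mem_set; auto.
Qed.

Lemma submod_add A B : GRing.submod_closed [in A] -> GRing.submod_closed [in B] ->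
  GRing.submod_closed [in subspace_add A B].
Proof.
move=> sA sB; apply: submod_closedI.
  by exists 0; [exact: submod0|exists 0; rewrite ?addr0 //; exact: submod0].
move=> a _ _ [x Ax [y By <-]] [x' Ax' [y' By' <-]].
exists (a *: x + x'); first exact: submodP.
exists (a *: y + y'); first exact: submodP.
by rewrite scalerDr addrACA.
Qed.

Definition is_orth_proj A x (p : V) :=
  A p /\ forall y, A y -> inner (x - p) y = 0.

(** [orth_proj] returns the default 0 where no projection exists, so existence is tracked
    separately; it is established below for subspaces of a finite-dimensional space and for closed
    subspaces of a Hilbert space. *)
Definition orth_projectable A := forall x, exists p, is_orth_proj A x p.

(** The difference of two candidates lies in [A] and is also a difference of two residuals, so it is
    orthogonal to itself. *)
Lemma orth_projE A x p : GRing.submod_closed [in A] ->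
  is_orth_proj A x p -> orth_proj A x = p.
Proof.
move=> sA pP; apply: xget_unique => // q [Aq qP].
case: pP => Ap pP; apply/subr0_eq/inner_eq0.
have Aqp := submodB sA Aq Ap.
have e : q - p = (x - p) - (x - q) by rewrite opprB [RHS]addrC subrKA.
by rewrite [X in inner X _]e innerBl pP // qP // subrr.
Qed.

Lemma orth_projP A x : orth_projectable A -> is_orth_proj A x (orth_proj A x).
Proof. by move=> /(_ x) h; exact: (xgetPex 0 h). Qed.

Lemma orth_proj_id A x : GRing.submod_closed [in A] -> A x -> orth_proj A x = x.
Proof.
by move=> sA Ax; apply: orth_projE => //; split=> // a _; rewrite subrr inner0l.
Qed.

Lemma orth_proj_orth A x : GRing.submod_closed [in A] ->
  (forall y, A y -> inner x y = 0) -> orth_proj A x = 0.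
Proof.
move=> sA h; apply: orth_projE => //; split=> [|a Aa]; first exact: submod0.
by rewrite subr0 h.
Qed.

Lemma orth_proj_linear A : GRing.submod_closed [in A] -> orth_projectable A ->
  linear (orth_proj A).
Proof.
move=> sA pA a x y; apply: orth_projE => //.
have [Ax xP] := orth_projP x pA; have [Ay yP] := orth_projP y pA.
split=> [|z Az]; first exact: submodP.
rewrite opprD addrACA -scalerBr innerDl innerZl xP // yP //.
by rewrite mulr0 addr0.
Qed.

Lemma range_orth_proj A : GRing.submod_closed [in A] -> orth_projectable A ->
  range (orth_proj A) = A.
Proof.
move=> sA pA; apply/seteqP; split=> [_ [x _ <-]|x Ax].
  by have [] := orth_projP x pA.
by exists x => //; exact: orth_proj_id.
Qed.

End InnerProduct.

Lemma submod_image {K : numFieldType} {theta : {rmorphism K -> K}}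
    {U V : innerProductType theta} (T : U -> V) (A : set U) : linear T ->
  GRing.submod_closed [in A] -> GRing.submod_closed [in T @` A].
Proof.
move=> lT sA; apply: submod_closedI => [|a _ _ [x Ax <-] [y Ay <-]].
  exists 0; first exact: submod0.
  by have := lT (-1) 0 0; rewrite scaler0 addr0 scaleN1r addNr.
by exists (a *: x + y); [exact: submodP|exact: lT].
Qed.

(** * Projections and adjoints in finite dimension *)

Section Euclidean.
Context {K : numFieldType} {theta : {rmorphism K -> K}}.
Context {F : euclideanType theta}.

(** Gram-Schmidt by induction on the generators: [r] is the part of the new generator [a] orthogonal
    to the old span, and the component of [x - p] along [r] is added to the old projection [p]. *)
Lemma span_orth_projectable (X : seq F) : orth_projectable [set` <<X>>%VS].
Proof.
elim: X => [|a X IH] x.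
  exists 0; split=> [|y] /=; first exact: mem0v.
  by rewrite span_nil memv0 => /eqP ->; rewrite inner0r.
have [p [Xp pP]] := IH x; have [q [Xq qP]] := IH a.
pose r := a - q; pose c := inner (x - p) r / inner r r.
have sX : (<<X>> <= <<a :: X>>)%VS by rewrite span_cons addvSr.
have aX : a \in <<a :: X>>%VS by rewrite memv_span // mem_head.
exists (p + c *: r); split=> [|y /=].
  by apply: rpredD; [exact: subvP Xp | apply/rpredZ/rpredB => //; exact: subvP Xq].
rewrite span_cons => /memv_addP[_ /vlineP[k ->] [z Xz ->]].
have -> : k *: a + z = k *: r + (k *: q + z).
  by rewrite addrA -scalerDr /r subrK.
rewrite innerDr innerZr opprD addrA (innerBl (x - p)) innerZl.
have -> : c * inner r r = inner (x - p) r.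
  have [->|r0] := eqVneq r 0; first by rewrite !inner0r mulr0.
  by rewrite /c divfK // gt_eqF // neq0_dnorm_gt0.
have Xkz : (k *: q + z) \in <<X>>%VS by apply: rpredD => //; exact: rpredZ.
rewrite subrr mulr0 add0r innerBl pP // innerZl qP //.
by rewrite mulr0 subr0.
Qed.

(** Take [U] of maximal dimension among the subspaces contained in [A]; adjoining a vector of [A] to
    [U] cannot raise the dimension, so the vector was already in [U]. *)
Lemma submod_vspace (A : set F) : GRing.submod_closed [in A] ->
  exists U : {vspace F}, A = [set` U].
Proof.
move=> sA.
pose P n := `[< exists2 U : {vspace F}, \dim U = n & [set` U] `<=` A >].
have exP : exists n, P n.
  exists 0%N; apply/asboolP; exists 0%VS; first exact: dimv0.
  by move=> x /=; rewrite memv0 => /eqP ->; exact: submod0.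
have leP n : P n -> (n <= \dim {:F})%N.
  by move=> /asboolP[U <- _]; exact/dimvS/subvf.
case: (ex_maxnP exP leP) => n /asboolP[U dU UA] maxn.
exists U; apply/seteqP; split=> // x Ax /=.
suff /eqP -> : U == (U + <[x]>)%VS by rewrite memvE addvSr.
rewrite eqEdim addvSl /= dU; apply: maxn; apply/asboolP; eexists; first by [].
move=> _ /memv_addP[u Uu [_ /vlineP[k ->] ->]].
by apply: submodD => //; [exact: UA | exact: submodZ].
Qed.

Lemma euclidean_orth_projectable (A : set F) : GRing.submod_closed [in A] ->
  orth_projectable A.
Proof.
move=> /submod_vspace[U ->]; rewrite -(span_basis (vbasisP U)).
exact: span_orth_projectable.
Qed.

(** [linfun] accepts any function but agrees with it only under linearity; here linearity is a
    proposition, so the bundled structure is built on the spot. *)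
Lemma linfun_linearE (f : F -> F) : linear f -> linfun f =1 f.
Proof.
move=> lf x; pose g : {linear F -> F} := HB.pack f (GRing.isLinear.Build _ _ _ _ f lf).
exact: (lfunE g).
Qed.

Context {H : innerProductType theta}.

(** Riesz representation: a vector representing [inner (T x) y] is built on larger and larger spans
    by the same Gram-Schmidt induction, up to a basis of [F]. *)
Lemma adjointP (T : F -> H) : linear T ->
  forall x y, inner (T x) y = inner x (adjoint T y).
Proof.
move=> lT x y.
pose g : {linear F -> H} := HB.pack T (GRing.isLinear.Build _ _ _ _ T lT).
have T0 : T 0 = 0 by exact: (raddf0 g).
suff [u uP] : exists u, forall x, inner (T x) y = inner x u.
  by have := xgetPex 0 (ex_intro [set u | forall x, inner (T x) y = inner x u] u uP).
have h (X : seq F) : exists u, forall x, x \in <<X>>%VS -> inner (T x) y = inner x u.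
  elim: X => [|a X [v vP]].
    exists 0 => z; rewrite span_nil memv0 => /eqP ->.
    by rewrite inner0l T0 inner0l.
  have [p [Xp pP]] := span_orth_projectable X v.
  have [q [Xq qP]] := span_orth_projectable X a.
  (* The outer [theta] cancels the conjugation that [inner] applies to scalars in its second
     argument. *)
  pose r := a - q; pose c := theta (inner (T r) y / inner r r).
  exists (p + c *: r) => t; rewrite span_cons.
  move=> /memv_addP[_ /vlineP[k ->] [z Xz ->]].
  have -> : k *: a + z = k *: r + (k *: q + z).
    by rewrite addrA -scalerDr /r subrK.
  have Xkz : (k *: q + z) \in <<X>>%VS by apply: rpredD => //; exact: rpredZ.
  rewrite lT innerDl innerZl (vP _ Xkz) [RHS]innerDl innerZl !(innerDr _ p) !innerZr.
  rewrite qP // add0r; congr (_ * _ + _).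
    have [->|r0] := eqVneq r 0.
      by rewrite T0 !inner0l mulr0.
    by rewrite /c (conj_involutive _ r0) // divfK // gt_eqF // neq0_dnorm_gt0.
  rewrite (inner_eq0C (qP _ Xkz)) mulr0 addr0; apply/subr0_eq.
  by rewrite -innerBr; exact/inner_eq0C/pP.
have [u uP] := h (vbasis {:F}).
by exists u => z; apply: uP; rewrite (span_basis (vbasisP _)) memvf.
Qed.

Lemma adjoint_linear (T : F -> H) : linear T -> linear (adjoint T).
Proof.
move=> lT a x y; apply: inner_inj => z.
by rewrite -adjointP // !innerDr !innerZr !adjointP.
Qed.

End Euclidean.

(** * Retained eigenspaces and the spectral pseudo-inverse *)

Section Spectral.
Context {K : numFieldType} {theta : {rmorphism K -> K}}.
Context {F : euclideanType theta}.
Context (D : 'End(F)) (tau : K).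
Implicit Types (u v w : F) (l m : K).

Lemma leigenspaceP l v : reflect (D v = l *: v) (v \in passmx.leigenspace D l).
Proof.
rewrite memv_ker add_lfunE opp_lfunE scale_lfunE id_lfunE subr_eq0.
exact: eqP.
Qed.

Lemma spectral_submod : GRing.submod_closed [in spectral_subspace D tau].
Proof.
apply: submod_closedI => [|a _ _ [n [u [-> uP]]] [m [v [-> vP]]]].
  by exists 0%N, (fun=> 0); split=> [|[]//]; rewrite big_ord0.
exists (n + m)%N, (fun i => match split i with inl j => a *: u j | inr j => v j end).
split=> [|i].
  rewrite big_split_ord scaler_sumr; congr (_ + _); apply: eq_bigr => i _.
    by rewrite (unsplitK (inl _ i)).
  by rewrite (unsplitK (inr _ i)).
case: splitP => j _; last exact: vP.
by have [l ll ul] := uP j; exists l => //; exact: memvZ.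
Qed.

Lemma spectral_stable v :
  spectral_subspace D tau v -> spectral_subspace D tau (D v).
Proof.
case=> n [w [-> wP]]; exists n, (fun i => D (w i)); split=> [|i].
  by rewrite linear_sum.
have [l ll /leigenspaceP Dw] := wP i; exists l => //.
by rewrite Dw memvZ //; apply/leigenspaceP.
Qed.

(** Summands are grouped by eigenvalue, so that eigenvalues become distinct and orthogonality
    applies. For [l] outside [s] the group is empty and [w l] is 0, hence the eigenvector equation
    holds for all [l]. *)
Lemma spectral_decomp v : spectral_subspace D tau v ->
  exists (s : seq K) (w : K -> F), [/\ uniq s, forall l, l \in s -> retained tau l,
    forall l, D (w l) = l *: w l & v = \sum_(l <- s) w l].
Proof.
case=> n [w [-> wP]].
have /choice[e eP] i : exists l, retained tau l /\ D (w i) = l *: w i.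
  by have [l ll /leigenspaceP wl] := wP i; exists l.
exists (undup (codom e)), (fun l => \sum_(i | e i == l) w i); split.
- exact: undup_uniq.
- by move=> l; rewrite mem_undup => /codomP[i ->]; have [] := eP i.
- move=> l; rewrite linear_sum scaler_sumr; apply: eq_bigr => i /eqP <-.
  by have [] := eP i.
- rewrite (exchange_big_dep xpredT) //=; apply: eq_bigr => i _.
  rewrite big_mkcond (bigD1_seq (e i)) ?undup_uniq ?mem_undup ?codom_f //= eqxx.
  by rewrite big1 ?addr0 // => l; rewrite eq_sym => /negPf ->.
Qed.

Context (D_sa : forall u v, inner (D u) v = inner u (D v)).

(** Self-adjointness first forces [theta m = m] when [v] is nonzero, and then
    [(l - m) * inner u v = 0]. *)
Lemma eigen_orth l m u v : D u = l *: u -> D v = m *: v -> l != m ->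
  inner u v = 0.
Proof.
move=> Du Dv lm; have [->|v0] := eqVneq v 0; first exact: inner0r.
have tm : theta m = m.
  have vv0 : inner v v != 0 by exact: lt0r_neq0 (neq0_dnorm_gt0 v v0).
  by have := D_sa v v; rewrite Dv innerZl innerZr => /(mulIf vv0).
have := D_sa u v; rewrite Du Dv innerZl innerZr tm => /eqP.
by rewrite -subr_eq0 -mulrBl mulf_eq0 subr_eq0 (negPf lm) => /eqP.
Qed.

Lemma inner_eigen_sum (s : seq K) (w : K -> F) l :
  uniq s -> (forall m, D (w m) = m *: w m) -> l \in s ->
  inner (w l) (\sum_(m <- s) w m) = inner (w l) (w l).
Proof.
move=> us Dw ls; rewrite (linear_sumr inner) (bigD1_seq l) //= big1 ?addr0 //.
by move=> m ml; apply: (eigen_orth (Dw l) (Dw m)); rewrite eq_sym.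
Qed.

(** By orthogonality the two sides are the sums of [tau * |w l|^2] and of [l * |w l|^2], compared
    term by term. *)
Lemma spectral_ge v : spectral_subspace D tau v ->
  tau * `|v| ^+ 2 <= inner (D v) v.
Proof.
case/spectral_decomp=> s [w [us sP Dw ve]].
have iv (u : K -> F) : inner (\sum_(l <- s) u l) v = \sum_(l <- s) inner (u l) v.
  exact: (linear_sumlz inner).
rewrite -inner_norm {1 3}ve linear_sum !iv mulr_sumr.
rewrite big_seq [leRHS]big_seq; apply: ler_sum => l ls.
rewrite /= Dw innerZl ve (inner_eigen_sum us Dw ls).
by apply: ler_wpM2r; [exact: inner_ge0 | have [] := sP l ls].
Qed.

Lemma spectral_norm_ge v : 0 <= tau -> spectral_subspace D tau v -> tau * `|v| <= `|D v|.
Proof.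
move=> t0 Sv; have [->|v0] := eqVneq v 0; first by rewrite linear0 !normr0 mulr0.
rewrite -(@ler_pM2r _ `|v|) ?normr_gt0 // -mulrA -expr2.
apply: le_trans (spectral_ge Sv) (le_trans _ (cauchy_schwarz _ _)).
rewrite ger0_norm //; apply: le_trans (spectral_ge Sv).
by rewrite mulr_ge0 ?exprn_ge0.
Qed.

(** Pairing [D v = 0] with [w l] gives [l * |w l|^2 = 0]. A retained [l] is nonzero: [l = 0] would
    force [tau = 0], where 0 is excluded. This also covers [tau = 0], for which the norm bound says
    nothing. *)
Lemma spectral_inj v : 0 <= tau -> spectral_subspace D tau v -> D v = 0 -> v = 0.
Proof.
move=> t0 /spectral_decomp[s [w [us sP Dw ve]]] Dv0.
rewrite ve big_seq big1 // => l ls; apply: inner_eq0.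
have [tl tl0] := sP l ls.
have := D_sa (w l) v; rewrite Dv0 inner0r Dw innerZl ve (inner_eigen_sum us Dw ls).
move=> /eqP; rewrite mulf_eq0 => /orP[/eqP l0|/eqP //].
by case: tl0 => //; apply/le_anti; rewrite t0 -{1}l0 tl.
Qed.

Lemma spectral_proj_range : range (spectral_proj D tau) = spectral_subspace D tau.
Proof.
exact/(range_orth_proj spectral_submod)/euclidean_orth_projectable/spectral_submod.
Qed.

(** The choice made by [spectral_pinv] is meaningful once some operator meets its specification. The
    witness projects onto [S] and then inverts [D] there, through an extension [M] of [D] on [S]
    that is invertible on all of [F]. *)
Lemma spectral_pinvP : 0 <= tau ->
  (forall v, spectral_subspace D tau v ->
     [/\ spectral_subspace D tau (spectral_pinv D tau v),
         spectral_pinv D tau (D v) = v & D (spectral_pinv D tau v) = v]) /\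
  (forall v, (forall u, spectral_subspace D tau u -> inner v u = 0) ->
     spectral_pinv D tau v = 0).
Proof.
move=> t0; rewrite /spectral_pinv spectral_proj_range.
set S := spectral_subspace D tau; set Q := (X in xget 0 X).
suff [G GP] : exists G, Q G by exact: (xgetPex 0 (ex_intro Q G GP)).
have sS : GRing.submod_closed [in S] := spectral_submod.
have pS := euclidean_orth_projectable sS.
pose E : 'End(F) := linfun (orth_proj S).
have EE v : E v = orth_proj S v by exact/linfun_linearE/orth_proj_linear.
have ES v : S (E v) by rewrite EE; have [] := orth_projP v pS.
have Eid v : S v -> E v = v by rewrite EE; exact: orth_proj_id.
have Eorth v u : S u -> inner (v - E v) u = 0.
  by rewrite EE; have [_] := orth_projP v pS; apply.
(* [M] acts as [D] on [S] and as the identity on its orthogonal complement. *)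
pose M : 'End(F) := (D \o E + (\1 - E))%VF.
have ME v : M v = D (E v) + (v - E v).
  by rewrite add_lfunE comp_lfunE add_lfunE opp_lfunE id_lfunE.
(* [v - E v] equals [M v - D (E v)], which lies in [S]; being orthogonal to [S] as well, it
   vanishes. *)
have MS v : S (M v) -> E v = v.
  move=> SMv; apply/esym/subr0_eq/inner_eq0/Eorth.
  have -> : v - E v = M v - D (E v) by rewrite ME [RHS]addrC addKr.
  exact: submodB (spectral_stable (ES v)).
have M0 : lker M == 0%VS.
  apply/lker0P => x y /eqP; rewrite -subr_eq0 -linearB => /eqP Mz.
  have Ez : E (x - y) = x - y by apply: MS; rewrite Mz; exact: submod0.
  apply/subr0_eq/spectral_inj => //; first by rewrite -Ez; exact: ES.
  by move: Mz => /=; rewrite ME Ez subrr addr0.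
exists (M^-1 \o E)%VF; split=> [v Sv|v vP]; last first.
  rewrite comp_lfunE; suff -> : E v = 0 by exact: linear0.
  by rewrite EE; exact: orth_proj_orth.
rewrite !comp_lfunE !Eid //; last exact: spectral_stable.
(* [M] sends [M^-1 v] to [v], which is in [S], so [M^-1 v] is in [S] too. *)
have EMv : E (M^-1%VF v) = M^-1%VF v by apply: MS; rewrite lker0_lfunVK.
split; first by rewrite -EMv; exact: ES.
  have <- : M v = D v by rewrite ME Eid // subrr addr0.
  exact: lker0_lfunK.
by rewrite -[RHS](lker0_lfunVK M0 v) ME EMv subrr addr0.
Qed.

End Spectral.

(** * Nearest points and projections in a Hilbert space *)

Section Projection.
Context {R : realType} {k : scalar_kind}.
Local Notation K := (scalar_field R k).

(** Distances take values in [K], which may be [R[i]] with its partial order. Nonnegative elements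
    are real there, so the infimum is taken over real parts. *)
Lemma scalar_inf (E : set K) : E !=set0 -> (forall x, E x -> 0 <= x) ->
  exists m : K, [/\ 0 <= m, forall x, E x -> m <= x &
    forall e, 0 < e -> exists2 x, E x & x < m + e].
Proof.
have real_inf (A : set R) : A !=set0 -> (forall x, A x -> 0 <= x) ->
    [/\ 0 <= inf A, forall x, A x -> inf A <= x &
      forall e, 0 < e -> exists2 x, A x & x < inf A + e].
  move=> A0 A_ge0; have lA : has_lbound A by exists 0 => x; exact: A_ge0.
  split; first exact: lb_le_inf.
  - by move=> x Ax; exact: ge_inf.
  - by move=> e e0; exact: inf_adherent.
case: k E => /= E E0 E_ge0; first by exists (inf E); exact: real_inf.
have reE x : E x -> ((complex.Re x)%:C)%C = x.
  by move=> /E_ge0; case: x => a b; rewrite lecE /= => /andP[/eqP -> _].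
have [||m0 m_le m_adh] := real_inf [set complex.Re x | x in E].
- by case: E0 => x Ex; exists (complex.Re x), x.
- by move=> _ [x Ex <-]; have := E_ge0 x Ex; rewrite lecE => /andP[].
exists ((inf [set complex.Re x | x in E])%:C)%C; split.
- by rewrite ler0c.
- by move=> x Ex; rewrite -(reE x Ex) lecR; apply: m_le; exists x.
- case=> a b; rewrite ltcE /= => /andP[/eqP -> a0].
  have [_ [x Ex <-] xlt] := m_adh a a0.
  by exists x => //; rewrite -(reE x Ex) ltcE /= addr0 eqxx.
Qed.

Context {H : hilbertType (scalar_conj R k)}.

(** The sets [A e] of near-minimizers generate a filter that the parallelogram law makes Cauchy; its
    limit attains the infimum [m]. *)
Lemma exists_nearest (V : set H) (x : H) : GRing.submod_closed [in V] ->
  closed V -> exists2 p, V p & forall a, V a -> `|x - p| <= `|x - a|.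
Proof.
move=> sV cV.
have [||m [m0 m_le m_adh]] := @scalar_inf [set `|x - a| | a in V].
- by exists `|x - 0|, 0 => //; exact: submod0.
- by move=> _ [a _ <-].
pose A (e : K) : set H := [set a | V a /\ `|x - a| < m + e].
have A_neq0 e : 0 < e -> A e !=set0.
  by move=> /m_adh[_ [a Va <-] ?]; exists a.
pose G := filter_from [set e : K | 0 < e] A.
have GF : ProperFilter G.
  apply: filter_from_proper => //; apply: filter_from_filter.
    by exists 1; exact: ltr01.
  move=> e1 e2 e1_gt0 e2_gt0.
  have [le12|/ltW le21] := real_leP (gtr0_real e1_gt0) (gtr0_real e2_gt0).
    exists e1 => // a [Va ltm]; split; split => //.
    by apply: lt_le_trans ltm _; rewrite lerD2l.
  exists e2 => // a [Va ltm]; split; split => //.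
  by apply: lt_le_trans ltm _; rewrite lerD2l.
(* The midpoint of [a] and [b] is in [V], hence at distance at least [m] from [x]. *)
have half_le a b : V a -> V b -> m *+ 2 <= `|(x - a) + (x - b)|.
  move=> Va Vb; have Vc : V (2^-1 *: (a + b)) by apply: submodZ => //; exact: submodD.
  have -> : (x - a) + (x - b) = (2 : K) *: (x - 2^-1 *: (a + b)).
    rewrite scalerBr scalerA divff ?pnatr_eq0 // scale1r scaler_nat.
    by rewrite mulr2n addrACA opprD.
  rewrite normrZ ger0_norm ?ler0n // mulr_natl ler_wMn2r //.
  by apply: m_le; exists (2^-1 *: (a + b)).
have Gcauchy : cauchy G.
  apply/cauchy_exP => eps eps0.
  (* Below, [|a - b|^2 < 4 * (m + e)^2 - 4 * m^2 = e * (8 * m + 4 * e)]. Since [d >= eps] gives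
     [e <= eps], this is at most [e * d = eps^2]. *)
  pose d := 8 * m + 4 * eps.
  have d0 : 0 < d by rewrite ltr_wpDl ?mulr_gt0 ?mulr_ge0.
  pose e := eps ^+ 2 / d.
  have e0 : 0 < e by rewrite divr_gt0 ?exprn_gt0.
  have e_le : e <= eps.
    rewrite ler_pdivrMr // expr2 ler_pM2l // /d ler_wpDl ?mulr_ge0 //.
    by rewrite ler_peMl ?ler1n // ltW.
  have [a [Va lta]] := A_neq0 e e0.
  exists a, e => // b [Vb ltb]; rewrite -ball_normE /=.
  rewrite -(@ltr_pXn2r _ 2) ?nnegrE ?normr_ge0 // ?(ltW eps0) //.
  have := parallelogram (x - a) (x - b).
  have -> : x - a - (x - b) = - (a - b) by rewrite opprB addrC subrKA opprB.
  rewrite normrN => /(canRL (addKr _)) ->.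
  have me0 : 0 <= m + e by rewrite addr_ge0 // ltW.
  have lta2 : `|x - a| ^+ 2 < (m + e) ^+ 2 by rewrite ltr_pXn2r ?nnegrE.
  have ltb2 : `|x - b| ^+ 2 < (m + e) ^+ 2 by rewrite ltr_pXn2r ?nnegrE.
  have ge2 : (m *+ 2) ^+ 2 <= `|(x - a) + (x - b)| ^+ 2.
    by rewrite ler_pXn2r ?nnegrE ?mulrn_wge0 //; exact: half_le.
  rewrite addrC.
  apply: (@lt_le_trans _ _ (2 * (m + e) ^+ 2 + 2 * (m + e) ^+ 2 - (m *+ 2) ^+ 2)).
    by rewrite ltr_leB // ltrD // ltr_pM2l.
  have -> : 2 * (m + e) ^+ 2 + 2 * (m + e) ^+ 2 - (m *+ 2) ^+ 2 =
    e * (8 * m + 4 * e) by ring.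
  have -> : eps ^+ 2 = e * d by rewrite /e divfK // gt_eqF.
  by rewrite ler_pM2l // lerD2l ler_pM2l.
have Glim : G --> lim G by apply/cauchy_cvgP.
pose p := lim G; exists p.
  (* The filter contains [A 1], a subset of the closed set [V]. *)
  apply: (closed_cvg (F := G) (u_ := id) V cV _ p) => //.
  by exists 1 => [|a []//]; exact: ltr01.
move=> a Va; apply: (@le_trans _ _ m); last by apply: m_le; exists a.
apply/ler_addgt0Pr => e e0.
have e20 : 0 < e / 2 by rewrite divr_gt0.
have Gball : G (ball p (e / 2)) by apply: Glim; exact: nbhsx_ballx.
have GA : G (A (e / 2)) by exists (e / 2).
have [b [/= pb [_ xb]]] : (ball p (e / 2) `&` A (e / 2)) !=set0.
  exact: (@filter_ex _ G _ _ (filterI Gball GA)).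
move: pb; rewrite -ball_normE /= => pb.
have -> : x - p = (x - b) - (p - b) by rewrite opprB subrKA.
apply: le_trans (ler_normB _ _) _.
have -> : m + e = (m + e / 2) + e / 2 by rewrite -addrA -splitr.
by rewrite lerD // ltW.
Qed.

(** For the nearest point [p], removing from [x - p] its component [c *: a] along [a] would lower
    the squared distance by [|c *: a|^2], so minimality forces that component to vanish. *)
Lemma closed_orth_projectable (V : set H) : GRing.submod_closed [in V] ->
  closed V -> orth_projectable V.
Proof.
move=> sV cV x; have [p Vp p_min] := exists_nearest x sV cV.
exists p; split=> // a Va; set y := x - p.
have [a0|a0] := eqVneq a 0; first by rewrite a0 inner0r.
pose c := inner y a / inner a a.
have aa0 : inner a a != 0 := lt0r_neq0 (neq0_dnorm_gt0 a a0).
have ca : inner (c *: a) a = inner y a by rewrite innerZl divfK.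
have o : inner (y - c *: a) (c *: a) = 0.
  by rewrite innerZr innerBl ca subrr mulr0.
have : `|c *: a| ^+ 2 <= 0.
  rewrite -(lerD2l (`|y - c *: a| ^+ 2)) -(pythagoras o) subrK addr0.
  rewrite ler_pXn2r ?nnegrE //.
  have -> : y - c *: a = x - (p + c *: a) by rewrite opprD addrA.
  by apply: p_min; apply: submodD => //; exact: submodZ.
rewrite -inner_norm => le0.
rewrite -ca (inner_eq0 (x := c *: a)) ?inner0l //.
by apply/le_anti; rewrite le0 inner_ge0.
Qed.

End Projection.

(** * Innovation identity, energy bound and update bound for the retained directions *)

Unset Implicit Arguments.

Theorem proposition3p1 (R : realType) (k : scalar_kind)
    (H : hilbertType (scalar_conj R k)) (V : set H) (f : H)
    (F : euclideanType (scalar_conj R k)) (T : {linear F -> H})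
    (tau : scalar_field R k) :
  GRing.submod_closed [in V] -> closed V -> bounded_operator T -> 0 <= tau ->
  let P := orth_proj V in
  let R_q : F -> H := fun x => T x - P (T x) in
  let D : 'End(F) := linfun (adjoint R_q \o R_q) in
  let b : F := adjoint R_q (f - P f) in
  let Pi := spectral_proj D tau in
  let Ddag := spectral_pinv D tau in
  let Gamma := inner b (Ddag b) in
  let W : set H := R_q @` range Pi in
  [/\ `|f - P f| ^+ 2 - `|f - orth_proj (subspace_add V W) f| ^+ 2 = Gamma,
      forall v : F, range Pi v -> tau * `|v| ^+ 2 <= inner (D v) v
    & 0 < tau -> `|Ddag b| <= tau^-1 * `|Pi b|].
Proof.
move=> sV cV _ tau0 P R_q D b Pi Ddag Gamma W.
have pV := closed_orth_projectable sV cV.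
have linR : linear R_q.
  move=> a x y; rewrite /R_q linearP [P _](orth_proj_linear sV pV) opprD addrACA.
  by rewrite scalerBr.
have adjR := adjointP linR.
have DE v : D v = adjoint R_q (R_q v).
  by rewrite linfun_linearE // => a x y; rewrite /= linR adjoint_linear.
have D_inner u v : inner (D u) v = inner (R_q u) (R_q v).
  by rewrite DE innerC -adjR -innerC.
have D_sa u v : inner (D u) v = inner u (D v) by rewrite D_inner DE -adjR.
set S := spectral_subspace D tau.
have rPi : range Pi = S := spectral_proj_range D tau.
have [G_S G_orth] := spectral_pinvP D_sa tau0; rewrite -/Ddag -/S in G_S G_orth.
have sS : GRing.submod_closed [in S] := spectral_submod D tau.
have [SPi b_orth] : is_orth_proj S b (Pi b).
  exact/orth_projP/euclidean_orth_projectable.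
(* [b - Pi b] is orthogonal to [S], where the pseudo-inverse vanishes; so [u = Ddag b] lies in [S]
   and solves [D u = Pi b]. *)
have GPi : Ddag b = Ddag (Pi b).
  by apply/subr0_eq; rewrite -linearB; apply: G_orth => u /b_orth.
have [Su _ Du] := G_S _ SPi; rewrite -GPi in Su Du.
set u := Ddag b in Su Du *.
have bR v : inner (f - P f) (R_q v) = inner b v by rewrite innerC adjR -innerC.
have bu v : S v -> inner b v = inner (D u) v.
  by move=> Sv; apply/subr0_eq; rewrite -innerBl Du b_orth.
split; last 2 first.
- by move=> v; rewrite rPi; exact: spectral_ge.
(* The lower bound [tau * |u| <= |D u|] on [S], with [D u = Pi b]. *)
- by move=> tau_gt0; rewrite mulrC ler_pdivlMr // mulrC -Du spectral_norm_ge.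
have sVW : GRing.submod_closed [in subspace_add V W].
  by apply: submod_add => //; apply: submod_image; rewrite ?rPi.
have V_orth x a : V a -> inner (x - P x) a = 0.
  by move=> Va; have [_] := orth_projP x pV; apply.
have projVW : orth_proj (subspace_add V W) f = P f + R_q u.
  apply: orth_projE => //; split.
    exists (P f); first by have [] := orth_projP f pV.
    by exists (R_q u) => //; exists u => //; rewrite rPi.
  move=> _ [a Va [_ [v + <-] <-]]; rewrite rPi => Sv.
  (* Both [f - P f] and [R_q u] are residuals of projections onto [V], so the pairing with [a]
     vanishes. *)
  rewrite opprD addrA innerDr innerBl V_orth // V_orth // subrr add0r.
  by rewrite innerBl bR bu // D_inner subrr.
have o : inner (f - P f - R_q u) (R_q u) = 0.
  by rewrite innerBl bR bu // D_inner subrr.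
(* The old residual [f - P f] splits into the new residual and [R_q u], orthogonal by [o]. *)
have := pythagoras o; rewrite subrK projVW (opprD (P f)) addrA => ->.
rewrite [LHS]addrC addKr -inner_norm -D_inner.
by rewrite /Gamma bu.
Qed.
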